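(* Let $(G,X,x_0)$ be a $0$-dimensional ambit and $\mathcal{B}$ the Boolean algebra of clopen subsets of $X$. Assume that there is a countable cofinal, upward directed by inclusion family $\mathcal{D}=\{\Delta_i\}_{i\in I}$ of subsets of $\mathcal{B}$ such that for every $\Delta\in\mathcal{D}$ the $G$-ambit $X$ has joint. fin. EDRdeg with respect to $\Delta$. Then every minimal left ideal in $E(X)$ is metrizable.
   Context: Compact spaces are Hausdorff. A flow $(G,X)$ is a topological group $G$ acting continuously on a compact space $X$. An ambit $(G,X,x_0)$ is a flow with a distinguished point $x_0\in X$ whose orbit is dense; it is $0$-dimensional if $X$ has a basis of clopen sets. The Ellis semigroup $E(X)$ is the closure in $X^X$ (product topology) of the set of maps $x\mapsto gx$, $g\in G$, with composition; minimal left ideals carry the subspace topology. A family $\mathcal{D}$ of subsets of $\mathcal{B}$ is cofinal if each $U\in\mathcal{B}$ belongs to some $\Delta\in\mathcal{D}$. An upward directed family is indexed as $\{\Delta_i\}_{i\in I}$ by a directed set $(I,\le)$ so that $i\le i'$ iff $\Delta_i\subseteq\Delta_{i'}$. A coloring is a function $c\colon G\to 2^n$, $n\ge 1$. For $\Sigma\subseteq\mathcal{B}$ (possibly infinite), $c$ is an externally definable $\Sigma$-coloring if there are $U_0,\dots,U_{n-1}\in\Sigma$ and $y_0,\dots,y_{n-1}\in X$ such that for all $g\in G$, $i<n$: $c(g)(i)=1$ if $y_i\in gU_i$ and $c(g)(i)=0$ if $y_i\notin gU_i$. The ambit has jointly finite externally definable Ramsey degree with respect to $\Sigma$ (joint.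 fin. EDRdeg with respect to $\Sigma$) if there is $l\ge 1$ such that for every externally definable $\Sigma$-coloring $c\colon G\to 2^n$ (any $n\geq 1$), every $k\ge 1$ and every $k$-element $A\subseteq G$, there is $h\in G$ with $|c[hA]|\le l$. *)

(* Defs.v *)
From HB Require Import structures.
From mathcomp Require Import all_boot all_order all_algebra.
From mathcomp Require Import all_classical all_reals all_analysis.

Set Implicit Arguments.
Unset Strict Implicit.
Unset Printing Implicit Defensive.

Import Order.TTheory GRing.Theory Num.Theory.

Local Open Scope classical_set_scope.

HB.mixin Record isTopologicalGroup G & Group G & Topological G := {
  mulg_continuous : continuous (fun p : G * G => (p.1 * p.2)%g) ;
  invg_continuous : continuous (fun g : G => (g^-1)%g)
}.

(* No separation axiom is imposed on the group. *)
#[short(type="topologicalGroupType")]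
HB.structure Definition TopologicalGroup :=
  {G of Group G & Topological G & isTopologicalGroup G}.

Section dynamics.
Variables (G : topologicalGroupType) (X : topologicalType).
Variable act : G -> X -> X.

Record is_flow : Prop := {
  flow_compact : compact [set: X] ;
  flow_hausdorff : hausdorff_space X ;
  flow_act1 : forall x, act 1%g x = x ;
  flow_actM : forall g h x, act (g * h)%g x = act g (act h x) ;
  flow_continuous : continuous (fun p : G * X => act p.1 p.2)
}.

Definition is_ambit (x0 : X) : Prop :=
  is_flow /\ dense [set act g x0 | g in [set: G]].

Definition ellis_semigroup : set {ptws X -> X} :=
  closure (range act : set {ptws X -> X}).

(* [2^n] is [{ffun 'I_n -> bool}]; [act g @` U i] is the translate [g U_i]. *)
Definition externally_definable_coloring (Sigma : set (set X)) (n : nat)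
    (c : G -> {ffun 'I_n -> bool}) : Prop :=
  exists (U : 'I_n -> set X) (y : 'I_n -> X),
    (forall i, Sigma (U i)) /\
    forall g i, c g i = (y i \in act g @` U i).

Definition joint_fin_EDRdeg (Sigma : set (set X)) : Prop :=
  exists2 l : nat, (1 <= l)%N &
    forall (n : nat) (c : G -> {ffun 'I_n -> bool}), (1 <= n)%N ->
      externally_definable_coloring Sigma c ->
    forall (k : nat) (A : set G), (1 <= k)%N -> (A #= `I_k)%card ->
      exists h : G, (c @` [set (h * a)%g | a in A] #<= `I_l)%card.

End dynamics.

(* The library's [zero_dimensional] is the weaker separation of points by
   clopen sets. *)
Definition has_clopen_basis (X : topologicalType) : Prop :=
  exists2 B : set (set X), B `<=` clopen & basis B.

Definition left_ideal (T : Type) (S L : set (T -> T)) : Prop :=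
  [/\ L !=set0, L `<=` S & forall f g, S f -> L g -> L (f \o g)].

(* Purely algebraic: ideals are not required to be closed. *)
Definition minimal_left_ideal (T : Type) (S L : set (T -> T)) : Prop :=
  left_ideal S L /\ forall L', left_ideal S L' -> L' `<=` L -> L' = L.

Definition cofinal_family (T : Type) (B : set T) (D : set (set T)) : Prop :=
  forall U, B U -> exists2 Delta, D Delta & Delta U.

Definition upward_directed (T : Type) (D : set (set T)) : Prop :=
  D !=set0 /\ forall Delta1 Delta2, D Delta1 -> D Delta2 ->
    exists2 Delta, D Delta & Delta1 `<=` Delta /\ Delta2 `<=` Delta.

Definition metrizable (R : realType) (T : topologicalType) : Prop :=
  exists d : T -> T -> R,
    [/\ forall x y, (0 <= d x y)%R,
        forall x y, d x y = 0%R <-> x = y,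
        forall x y, d x y = d y x,
        forall x y z, (d x z <= d x y + d y z)%R &
        forall x, nbhs x = nbhs_ball_ (fun a e => [set b | (d a b < e)%R]) x].

(* Main.v *)
Require Import Defs.
From HB Require Import structures.
From mathcomp Require Import all_boot all_order all_algebra.
From mathcomp Require Import all_classical all_reals all_analysis.

(** Write [E] for the Ellis semigroup. For a map [f : X -> X], a point [y] and
    a clopen set [U], consider the yes/no test [U (f y)]; finitely many tests
    give [f] a code, a finite word of booleans, and codes are locally constant
    in [f] for the topology of pointwise convergence.

    Fix [Delta] in [D] and let [l] be its Ramsey bound. The colorings of [G]
    definable by sets of [Delta] are exactly the codes of the translations
    [act g^-1], so the Ramsey property says that, for a given finite list of
    tests and every finite [A] in [G], some [h] makes the translations
    [act (g * h)], [g] in [A], realize at most [l] codes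
    ([joint_fin_EDRdeg_codes]). As [E] is compact, the maps [act h] accumulate
    at some [eta] in [E] such that all the maps [act g \o eta] together realize
    at most [l] codes ([joint_fin_EDRdeg_limit]). If [mu] is in the minimal left
    ideal [M], then minimality gives [M = E \o eta \o mu], and the orbit of
    [eta] is dense in [E \o eta]; applying the previous bound to the tests
    moved by [mu], at most [l] codes are realized on [M]
    ([minimal_left_ideal_codes]).

    The bound [l] does not depend on the number of tests. Hence some finite
    list of tests already decides all tests with sets of [Delta] on [M]
    ([bounded_codes_determined]), and the relation of passing the same
    [Delta]-tests has open classes in [M] ([same_tests_near]). By cofinality
    and since the clopen sets form a basis, the classes of these relations,
    for [Delta] in the countable family [D], generate the topology of [M] and
    separate its points. A countable family of equivalence relations with these
    properties yields an ultrametric ([metrizable_of_equivalences]). *)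

Set Implicit Arguments.
Unset Strict Implicit.
Unset Printing Implicit Defensive.

Import Order.TTheory GRing.Theory Num.Theory.

Local Open Scope classical_set_scope.

(** * Families of tests realizing boundedly many codes *)

Section codes.
Variables (I T : Type) (b : I -> T -> bool).

Definition code (s : seq I) (x : T) : seq bool := [seq b i x | i <- s].

End codes.

Lemma uniq_map_inj (T1 T2 : eqType) (f : T1 -> T2) (s : seq T1) :
  uniq [seq f x | x <- s] -> {in s &, injective f}.
Proof.
elim: s => [//|z s IHs] /= /andP[fz us] x y.
rewrite !inE => /predU1P[->|xs] /predU1P[->|ys] //.
- by move=> fzy; case/negP: fz; rewrite fzy map_f.
- by move=> fxz; case/negP: fz; rewrite -fxz map_f.
- exact: IHs.
Qed.

(** As long as no finite list of tests determines all the others, any finite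
    set of points with distinct codes can be enlarged: two points with the same
    code are told apart by a further test [i], and once [i] is added to the
    list, one of these two points has a code realized by none of the points
    already collected. *)
Lemma bounded_codes_determined (I : Type) (T : eqType) (b : I -> T -> bool)
    (l : nat) :
  (forall s (xs : seq T), uniq [seq code b s x | x <- xs] ->
    (size xs <= l)%N) ->
  exists s, forall x y, code b s x = code b s y ->
    forall i, b i x = b i y.
Proof.
move=> bounded; apply: contrapT => /forallNP undetermined.
suff grow k : exists s (xs : seq T),
    uniq [seq code b s x | x <- xs] /\ size xs = k.
  by have [s [xs [/bounded + xsl]]] := grow l.+1; rewrite xsl ltnn.
elim: k => [|k [s [xs [s_xs <-]]]]; first by exists [::], [::].
have [x [y [i [xy bxy]]]] : exists x y i,
    code b s x = code b s y /\ b i x <> b i y.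
  apply: contrapT => none; apply: (undetermined s) => x y xy i.
  by apply: contrapT => bxy; apply: none; exists x, y, i.
(* Dropping the answer to the new test is [behead]. *)
have is_xs : uniq [seq code b (i :: s) z | z <- xs].
  by apply: (@map_uniq _ _ behead); rewrite -map_comp.
have [z z_xs] : exists z,
    code b (i :: s) z \notin [seq code b (i :: s) w | w <- xs].
  apply: contrapT => /forallNP all_in.
  (* If both codes were taken, the points taking them would have equal codes
     for [s], hence coincide, contradicting that [i] separates [x] and [y]. *)
  have /negP := all_in x; rewrite negbK => /mapP[x' x'xs [bx cx]].
  have /negP := all_in y; rewrite negbK => /mapP[y' y'xs [by_ cy]].
  apply: bxy; rewrite bx by_; congr (b i _).
  suff inj : {in xs &, injective (code b s)} by apply: inj; rewrite // -cx -cy.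
  exact: uniq_map_inj s_xs.
by exists (i :: s), (z :: xs); rewrite /= z_xs.
Qed.

Lemma uniq_size_le_card (T : choiceType) (u : seq T) (A : set T) (l : nat) :
  uniq u -> (forall x, x \in u -> A x) -> (A #<= `I_l)%card ->
  (size u <= l)%N.
Proof.
case: u => [//|x0 u] uu uA Al; set v := x0 :: u.
rewrite -card_le_II; apply: card_le_trans Al.
have /card_eqPle[_ le] : (nth x0 v @` `I_(size v) #= `I_(size v))%card.
  apply: inj_card_eq => i j; rewrite !inE => iv jv /eqP.
  by rewrite nth_uniq// => /eqP.
apply: card_le_trans le _; apply: subset_card_le => _ [i iv <-].
by apply: uA; apply: mem_nth.
Qed.

(** * The topology of pointwise convergence *)

Lemma continuous_closure_sub (S T : topologicalType) (phi : S -> T)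
    (A : set S) (C : set T) :
  continuous phi -> closed C -> (forall x, A x -> C (phi x)) ->
  forall x, closure A x -> C (phi x).
Proof.
move=> cphi cC AC x Ax; have : closed (phi @^-1` C).
  by move/continuous_closedP: cphi; exact.
by apply; apply: closureS Ax; exact: AC.
Qed.

Lemma set_type_cvg (T : topologicalType) (A : set T)
    (F : set_system (set_type A)) (x : set_type A) :
  Filter F -> set_val @ F --> set_val x -> F --> x.
Proof.
move=> FF cvF B [C [[W oW <-] Wx] CB].
rewrite nbhs_filterE; apply: filterS CB _.
by apply: cvF; apply: open_nbhs_nbhs.
Qed.

Section pointwise_topology.
Variables (S : choiceType) (Y : topologicalType).

Lemma ptws_cvg (F : set_system {ptws S -> Y}) (f : {ptws S -> Y}) :
  Filter F -> (forall x, (fun g : {ptws S -> Y} => g x) @ F --> f x) ->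
  F --> f.
Proof.
move=> FF cvF; apply/cvg_sup => x A [B [[C oC <-] Cfx] CA].
rewrite nbhs_filterE; apply: filterS CA _.
by apply: (cvF x); apply: open_nbhs_nbhs.
Qed.

Lemma ptws_eval_continuous (x : S) :
  continuous (fun f : {ptws S -> Y} => f x).
Proof. exact: (@proj_continuous S (fun=> Y) x). Qed.

Lemma ptws_comp_continuous (u : Y -> Y) (p : S -> S) : continuous u ->
  continuous (fun f : {ptws S -> Y} => (u \o f \o p) : {ptws S -> Y}).
Proof.
move=> cu f; apply: ptws_cvg => [|x].
  by apply: fmap_filter; exact: nbhs_filter.
apply: (@continuous_comp _ _ _ (fun f : {ptws S -> Y} => f (p x)) u).
  exact: ptws_eval_continuous.
exact: cu.
Qed.

End pointwise_topology.

(** * A metrization criterion *)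

Section metrization.
Variables (R : realType) (T : topologicalType) (e : nat -> T -> T -> Prop).
Hypothesis e_refl : forall n x, e n x x.
Hypothesis e_sym : forall n x y, e n x y -> e n y x.
Hypothesis e_trans : forall n x y z, e n x y -> e n y z -> e n x z.
Hypothesis e_open : forall n x, nbhs x (e n x).
Hypothesis e_cvg : forall x,
  filter_from [set: nat]
    (fun n => [set y | forall k, (k <= n)%N -> e k x y]) --> x.
Hypothesis e_sep : forall x y, (forall n, e n x y) -> x = y.

Local Open Scope ring_scope.

(** The distance is the inverse of the rank of the first relation that
    separates the two points. *)
Let dist (x y : T) : R :=
  if pselect (exists n, `[< ~ e n x y >]) is left ex
  then (ex_minn ex).+1%:R^-1 else 0.

Let dist_spec (x y : T) :
  ((forall n, e n x y) /\ dist x y = 0) \/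
  exists n, [/\ ~ e n x y, forall k, (k < n)%N -> e k x y
    & dist x y = n.+1%:R^-1].
Proof.
rewrite /dist; case: pselect => [ex|nex]; last first.
  left; split => // n; apply: contrapT => enxy; apply: nex.
  by exists n; apply/asboolP.
right; case: ex_minnP => n /asboolP nexy minn; exists n; split => // k kn.
apply: contrapT => nek; move: (minn k); rewrite leqNgt kn => /(_ _)/negP.
by apply => //; apply/asboolP.
Qed.

Let inv_le (m n : nat) : (m <= n)%N -> n.+1%:R^-1 <= m.+1%:R^-1 :> R.
Proof. by move=> mn; rewrite lef_pV2 ?posrE ?ltr0n// ler_nat. Qed.

Let dist_ge0 x y : 0 <= dist x y.
Proof.
by case: (dist_spec x y) => [[_ ->]//|[n [_ _ ->]]]; rewrite invr_ge0.
Qed.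

Let dist_ge n x y : ~ e n x y -> n.+1%:R^-1 <= dist x y.
Proof.
move=> nexy; case: (dist_spec x y) => [[/(_ n)//]|[m [_ m_min ->]]].
by apply: inv_le; rewrite leqNgt; apply/negP => /m_min.
Qed.

Let dist_le x y : dist x y <= dist y x.
Proof.
case: (dist_spec x y) => [[_ ->]//|[n [nexy _ ->]]].
by apply: dist_ge => /e_sym.
Qed.

(** The balls of radius [n.+1%:R^-1] are the intersections of the classes of
    the first [n.+1] relations, and the triangle inequality comes from
    transitivity: a relation that separates [x] from [z] separates one of them
    from [y]. *)
Lemma metrizable_of_equivalences : metrizable R T.
Proof.
exists dist; split => //.
- move=> x y; split => [dxy|->].
    apply: e_sep => n; apply: contrapT => /dist_ge.
    by rewrite dxy leNgt invr_gt0 ltr0n.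
  by case: (dist_spec y y) => [[_ ->]//|[n [/(_ (e_refl n y))]]].
- by move=> x y; apply/eqP; rewrite eq_le !dist_le.
- move=> x y z.
  case: (dist_spec x z) => [[_ ->]|[n [nexz _ ->]]]; first exact: addr_ge0.
  have [exy|nexy] := pselect (e n x y).
    rewrite (@le_trans _ _ (dist y z)) ?lerDr// dist_ge// => eyz.
    by apply: nexz; apply: e_trans exy eyz.
  by rewrite (@le_trans _ _ (dist x y)) ?lerDl// dist_ge.
- move=> x; apply/seteqP; split => A.
    move=> /e_cvg[n _ nA]; exists n.+1%:R^-1 => /=; first by rewrite invr_gt0.
    move=> y dxy; apply: nA => k kn; apply: contrapT => /dist_ge nek.
    by move: dxy => /=; rewrite ltNge (le_trans (inv_le kn) nek).
  move=> [eps /= eps0 epsA].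
  have [n] := ltr_add_invr eps0; rewrite add0r => neps.
  have near_n : \forall y \near x, forall k, (k < n)%N -> e k x y.
    elim: n {neps} => [|n IHn]; first by apply: nearW.
    near=> y => k; rewrite ltnS leq_eqVlt => /predU1P[->|kn].
      by near: y; exact: e_open.
    by move: k kn; near: y.
  apply: filterS near_n => y ny; apply: epsA => /=.
  case: (dist_spec x y) => [[_ ->]//|[m [nexy _ ->]]].
  apply: le_lt_trans neps; apply: inv_le; rewrite leqNgt.
  by apply/negP => /ny.
Unshelve. all: by end_near.
Qed.

End metrization.

(** * Codes of self-maps of [X] *)

Section coordinate_tests.
Variables (X : topologicalType) (Sigma : set (set X)).

Definition test (q : X * set_type Sigma) (f : X -> X) : bool :=
  `[< set_val q.2 (f q.1) >].

Hypothesis Sigma_clopen : Sigma `<=` clopen.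

Lemma code_locally_constant (s : seq (X * set_type Sigma))
    (f : {ptws X -> X}) :
  \forall g \near f, code test s g = code test s f.
Proof.
have Ff : Filter (nbhs f) := nbhs_filter f.
elim: s => [|[x U] s IHs]; first exact: (@filterE _ (nbhs f) Ff).
suff test_const : \forall g \near f, test (x, U) g = test (x, U) f.
  apply: (@filterS2 _ (nbhs f) Ff) test_const IHs => g gx gs.
  by rewrite /= gx; congr cons.
have [oU cU] := Sigma_clopen (set_valP U).
have evalx := @ptws_eval_continuous X X x f.
have [Ufx|nUfx] := pselect (set_val U (f x)).
  have : \forall g \near f, set_val U (g x).
    by apply: (evalx (set_val U)); apply: open_nbhs_nbhs.
  by apply: filterS => g Ugx; rewrite /test !asboolT.
have : \forall g \near f, (~` set_val U) (g x).
  apply: (evalx (~` set_val U)); apply: open_nbhs_nbhs; split=> //.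
  exact: closed_openC.
by apply: filterS => g Ugx; rewrite /test !asboolF.
Qed.

End coordinate_tests.

Arguments test {X Sigma}.

(** * Codes on a minimal left ideal of the Ellis semigroup *)

Section ellis.
Variables (G : topologicalGroupType) (X : topologicalType).
Variable act : G -> X -> X.
Hypothesis flowX : is_flow act.

Lemma act_continuous g : continuous (act g).
Proof.
move=> x; apply: (@continuous_comp _ _ _ (fun y => (g, y))
  (fun p => act p.1 p.2)).
  by apply: cvg_pair; [exact: cvg_cst|exact: cvg_id].
exact: (flow_continuous flowX).
Qed.

(** Composition of self-maps is continuous in its left factor, but in its right
    factor in general only if the left one is a continuous map, such as a
    translation. So the left factor has to be reduced to a translation before
    the right one is. *)
Lemma ellis_semigroup_comp (f g : {ptws X -> X}) :
  ellis_semigroup act f -> ellis_semigroup act g ->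
  ellis_semigroup act (f \o g).
Proof.
move=> Ef Eg.
refine (@continuous_closure_sub {ptws X -> X} {ptws X -> X} (fun f => f \o g)
  (range act) (ellis_semigroup act) _ _ _ f Ef).
- exact: (@ptws_comp_continuous X X id g (fun x => @cvg_id _ _)).
- exact: closed_closure.
move=> _ [h _ <-].
refine (@continuous_closure_sub {ptws X -> X} {ptws X -> X} (fun g => act h \o g)
  (range act) (ellis_semigroup act) _ _ _ g Eg).
- exact: (@ptws_comp_continuous X X (act h) id (@act_continuous h)).
- exact: closed_closure.
move=> _ [k _ <-]; apply: subset_closure; exists (h * k)%g => //.
by apply/funext => x; rewrite (flow_actM flowX).
Qed.

Lemma ellis_semigroup_compact : compact (ellis_semigroup act).
Proof.
apply: (@subclosed_compact _ _ setT); first exact: closed_closure.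
  have := @tychonoff X (fun=> X) (fun=> setT) (fun=> flow_compact flowX).
  by congr compact; apply/seteqP; split.
by [].
Qed.

Variable M : set {ptws X -> X}.
Hypothesis minM : minimal_left_ideal (ellis_semigroup act) M.

Lemma minimal_left_ideal_eq f : M f ->
  M = [set g \o f | g in ellis_semigroup act].
Proof.
have [[_ _ Mabs] Mmin] := minM.
move=> Mf; apply/esym/Mmin; last by move=> _ [g Eg <-]; exact: Mabs.
split.
- by exists (act 1%g \o f), (act 1%g) => //; apply: subset_closure; exists 1%g.
- by move=> _ [g Eg <-]; have [[_ ME _] _] := minM; apply: ME; exact: Mabs.
- move=> g _ Eg [k Ek <-]; exists (g \o k) => //.
  exact: ellis_semigroup_comp.
Qed.

Section ramsey.
Variable Sigma : set (set X).
Hypothesis Sigma_clopen : Sigma `<=` clopen.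

(** The color [c g] records for which [i] one has [y i \in act g @` U i], that
    is [U i (act g^-1 (y i))]: it is the code of [act g^-1]. So the Ramsey
    property is applied to the set of inverses of [A]. *)
Lemma joint_fin_EDRdeg_codes : joint_fin_EDRdeg act Sigma ->
  exists l, forall (s : seq (X * set_type Sigma)) (A : seq G), exists h,
    (size (undup [seq code test s (act (g * h)%g) | g <- A]) <= l)%N.
Proof.
move=> [l l1 ramsey]; exists l => s A.
have [s0|/negP s_gt0] := boolP (0 < size s)%N; last first.
  (* Without tests, the only code is the empty word. *)
  exists 1%g; apply: leq_trans l1.
  apply: (@uniq_leq_size _ _ [:: ([::] : seq bool)]); first exact: undup_uniq.
  move=> u; rewrite mem_undup => /mapP[g _ ->].
  by case: (s) s_gt0.
have [->|[g0 g0A]] : A = [::] \/ exists g, g \in A.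
- by case: (A) => [|g A']; [left|right; exists g; rewrite mem_head].
- by exists 1%g.
pose c (g : G) : {ffun 'I_(size s) -> bool} :=
  [ffun i => (tnth (in_tuple s) i).1 \in
    act g @` set_val (tnth (in_tuple s) i).2].
have c_ext : externally_definable_coloring act Sigma c.
  exists (fun i => set_val (tnth (in_tuple s) i).2),
    (fun i => (tnth (in_tuple s) i).1); split => [i|g i].
    exact: set_valP.
  by rewrite ffunE.
have codeE g : code test s (act g) = codom (c g^-1%g).
  rewrite -[s in LHS](map_tnth_enum (in_tuple s)) /code -map_comp.
  apply: eq_map => i /=; rewrite ffunE /test.
  apply/asboolP/idP => [Ugx|].
    rewrite inE; exists (act g (tnth (in_tuple s) i).1) => //.
    by rewrite -(flow_actM flowX) mulVg (flow_act1 flowX).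
  rewrite inE => -[x Ux <-].
  by rewrite -(flow_actM flowX) mulgV (flow_act1 flowX).
pose A' := [set` [seq g^-1%g | g <- A]].
have /finite_setP[k A'k] : finite_set A' by exact: finite_seq.
have k_gt0 : (1 <= k)%N.
  case: k A'k => // A'0; have : (A' #= (@set0 nat))%card.
    by apply: card_eq_trans A'0 _; rewrite II0.
  rewrite card_eq0 => /eqP A'0'.
  have : A' g0^-1%g by apply: map_f.
  by rewrite A'0'.
have [h hA'] := ramsey _ c s0 c_ext k A' k_gt0 A'k.
exists h^-1%g; apply: (uniq_size_le_card (undup_uniq _)) (card_le_trans _ hA').
  2: exact: (@card_image_le _ _
    (fun w : {ffun 'I_(size s) -> bool} => codom w)).
move=> u; rewrite mem_undup => /mapP[g gA ->].
exists (c (h * g^-1)%g); last by rewrite codeE invgM invgK.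
exists (h * g^-1)%g => //; exists g^-1%g => //.
exact: map_f.
Qed.

(** Compactness turns the choice of [h], made separately for each finite [A],
    into a single [eta] serving all of them: the translations good for [A] form
    a filter base as [A] grows, and being good for [A] is a clopen condition
    because codes are locally constant. *)
Lemma joint_fin_EDRdeg_limit : joint_fin_EDRdeg act Sigma ->
  exists l, forall s : seq (X * set_type Sigma),
    exists2 eta, ellis_semigroup act eta & forall A : seq G,
    (size (undup [seq code test s (act g \o eta) | g <- A]) <= l)%N.
Proof.
move=> /joint_fin_EDRdeg_codes[l bounded]; exists l => s.
pose good (A : seq G) : set {ptws X -> X} := [set act h | h in
  [set h | (size (undup [seq code test s (act (g * h)%g) | g <- A]) <= l)%N]].
pose F : set_system {ptws X -> X} := filter_from [set: seq G] good.
have good_sub A B : {subset A <= B} -> good B `<=` good A.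
  move=> AB _ [h /= hB <-]; exists h => //=; apply: leq_trans hB.
  apply: uniq_leq_size; first exact: undup_uniq.
  by move=> u; rewrite !mem_undup => /mapP[g /AB gB ->]; exact: map_f.
have FF : ProperFilter F.
  apply: filter_from_proper => [|A _]; last first.
    by have [h hA] := bounded s A; exists (act h), h.
  apply: filter_from_filter; first by exists [::].
  move=> A B _ _; exists (A ++ B) => //; rewrite subsetI.
  split; apply: good_sub => g gA.
    by rewrite mem_cat gA.
  by rewrite mem_cat gA orbT.
have [|eta [Eeta cl_eta]] := ellis_semigroup_compact FF.
  by exists [::] => // _ [h _ <-]; apply: subset_closure; exists h.
exists eta => // A.
have near_eta : nbhs eta [set f : {ptws X -> X} |
    [seq code test s (act g \o f) | g <- A] =
    [seq code test s (act g \o eta) | g <- A]].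
  have Feta : Filter (nbhs eta) := nbhs_filter eta.
  elim: A => [|g A IHA]; first exact: (@filterE _ (nbhs eta) Feta).
  have cg : continuous (fun f : {ptws X -> X} => (act g \o f) : {ptws X -> X}).
    exact: (@ptws_comp_continuous X X (act g) id (@act_continuous g)).
  have := cg eta _ (code_locally_constant Sigma_clopen s (act g \o eta)).
  apply: (@filterS2 _ (nbhs eta) Feta) IHA => f /= fA fg.
  by rewrite fA; congr cons.
have [_ [[h /= hA <-] /= <-]] :=
  cl_eta _ _ (@in_filter_from _ _ _ good A I) near_eta.
suff -> : [seq code test s (act g \o act h) | g <- A] =
  [seq code test s (act (g * h)%g) | g <- A] by [].
apply: eq_map => g; congr code; apply/funext => x.
by rewrite /= (flow_actM flowX).
Qed.

(** The code of [f \o mu] for a list of tests is the code of [f] for the same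
    tests taken at the images of their points under [mu]. It thus suffices to
    bound the codes of [f \o eta] for [f] in the Ellis semigroup, and these are
    codes of [act g \o eta] because [f] is a limit of translations. *)
Lemma minimal_left_ideal_codes : joint_fin_EDRdeg act Sigma ->
  exists l, forall (s : seq (X * set_type Sigma)) (ms : seq (set_type M)),
    uniq [seq code test s (set_val m) | m <- ms] -> (size ms <= l)%N.
Proof.
move=> /joint_fin_EDRdeg_limit[l limit]; exists l => s ms s_ms.
have [[[mu Mmu] ME Mabs] _] := minM.
have [eta Eeta eta_l] := limit [seq (mu q.1, q.2) | q <- s].
have codeE f : code test s (f \o mu) = code test [seq (mu q.1, q.2) | q <- s] f.
  by rewrite /code -map_comp.
have approx (m : set_type M) : exists g,
    code test s (set_val m) =
    code test [seq (mu q.1, q.2) | q <- s] (act g \o eta).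
  have := set_valP m; rewrite {1}(minimal_left_ideal_eq (Mabs _ _ Eeta Mmu)).
  move=> [f Ef fm].
  have ceta : continuous (fun f : {ptws X -> X} => (f \o eta) : {ptws X -> X}).
    exact: (@ptws_comp_continuous X X id eta (fun x => @cvg_id _ _)).
  have [_ [[g _ <-] /= gf]] := Ef _ (ceta f _
    (code_locally_constant Sigma_clopen [seq (mu q.1, q.2) | q <- s] (f \o eta))).
  exists g; rewrite gf -codeE; congr code; exact: esym fm.
have [gg ggE] := choice approx.
have := eta_l [seq gg m | m <- ms].
by rewrite -map_comp -(eq_map ggE) undup_id// size_map.
Qed.

Lemma same_tests_near (m : set_type M) : joint_fin_EDRdeg act Sigma ->
  \forall m' \near m, forall q : X * set_type Sigma,
    test q (set_val m) = test q (set_val m').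
Proof.
move=> /minimal_left_ideal_codes[l bounded].
have [s sP] := @bounded_codes_determined _ _
  (fun q (m : set_type M) => test (Sigma := Sigma) q (set_val m)) l bounded.
have near_m : \forall m' \near m,
    code test s (set_val m') = code test s (set_val m).
  exact: (@initial_continuous (set_type M) {ptws X -> X} set_val m _
    (code_locally_constant Sigma_clopen s (set_val m))).
by apply: filterS near_m => m' /esym /sP.
Qed.

End ramsey.
End ellis.

(** * Metrizability of minimal left ideals *)

Theorem corollary3p31 (R : realType) (G : topologicalGroupType)
    (X : topologicalType) (act : G -> X -> X) (x0 : X)
    (ambitX : is_ambit act x0) (dimX : has_clopen_basis X)
    (D : set (set (set X)))
    (D_clopen : forall Delta, D Delta -> Delta `<=` clopen)
    (D_countable : countable D)
    (D_cofinal : cofinal_family clopen D)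
    (D_directed : upward_directed D)
    (D_EDRdeg : forall Delta, D Delta -> joint_fin_EDRdeg act Delta)
    (M : set {ptws X -> X})
    (minM : minimal_left_ideal (ellis_semigroup act) M) :
  metrizable R (set_type M).
Proof.
have [flowX _] := ambitX; have [B B_clopen [_ B_basis]] := dimX.
have [rank rank_inj] := countable_injP _ D_countable.
(* At most one [Delta] has rank [n]; if there is none, [e n] is the total
   relation. *)
pose e n (m m' : set_type M) := forall Delta, D Delta -> rank Delta = n ->
  forall q : X * set_type Delta, test q (set_val m) = test q (set_val m').
have eP m m' U (y : X) Delta : D Delta -> Delta U -> e (rank Delta) m m' ->
    U (set_val m y) -> U (set_val m' y).
  move=> DDelta DU emm' Umy.
  have := emm' _ DDelta erefl (y, exist _ U (mem_set DU)).
  by rewrite /test /= asboolT// => /esym/asboolP.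
have local y V : nbhs y V ->
    exists U Delta, [/\ D Delta, Delta U, U y & U `<=` V].
  move=> /B_basis[U [BU Uy] UV].
  have [Delta DDelta DU] := D_cofinal _ (B_clopen _ BU).
  by exists U, Delta.
apply: (@metrizable_of_equivalences R _ e).
- by [].
- by move=> n m m' emm' Delta DDelta Deltan q; rewrite (emm' _ DDelta Deltan).
- move=> n m m' m'' e1 e2 Delta DDelta Deltan q.
  by rewrite (e1 _ DDelta Deltan) (e2 _ DDelta Deltan).
- move=> n m; have [[Delta [DDelta Deltan]]|none] :=
    pselect (exists Delta, D Delta /\ rank Delta = n); last first.
    apply: (@filterE _ (nbhs m) (nbhs_filter m)) => m' Delta DDelta Deltan.
    by exfalso; apply: none; exists Delta.
  apply: filterS (same_tests_near flowX minM (D_clopen _ DDelta) m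
    (D_EDRdeg _ DDelta)).
  move=> m' mm' Delta' DDelta' Delta'n.
  suff -> : Delta' = Delta by [].
  by apply: rank_inj; rewrite ?inE// Delta'n.
- move=> m; set F := filter_from _ _.
  have FF : Filter F.
    apply: filter_from_filter; first by exists 0%N.
    move=> i j _ _; exists (maxn i j) => // m' mm'; split => k kij; apply: mm'.
      by rewrite leq_max kij.
    by rewrite leq_max kij orbT.
  apply: set_type_cvg; apply: ptws_cvg => y V.
  move=> /local[U [Delta [DDelta DU Um UV]]].
  exists (rank Delta) => // m' mm'; apply: UV.
  exact: eP DDelta DU (mm' _ (leqnn _)) Um.
- move=> m m' mm'; apply/val_inj/funext => y.
  apply: (flow_hausdorff flowX) => V W.
  move=> /local[U [Delta [DDelta DU Um UV]]] /nbhs_singleton Wm'.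
  exists (set_val m' y); split => //.
  by apply: UV; exact: eP DDelta DU (mm' _) Um.
Qed.
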